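(* Let $k\ge 1$ be an integer. For every integer $m\ge 0$, the following identity of polynomials in $x$ holds: $$E_m^{(k)}(x)=\sum_{n=0}^{m}Ch_n^{(k)}(x)\,S_2(m,n).$$
   Context: Let $p$ be an odd prime. For a continuous function $f$ on $\mathbb{Z}_p$, the fermionic $p$-adic integral is $$\int_{\mathbb{Z}_p} f(x)\,d\mu_{-1}(x)=\lim_{N\to\infty}\sum_{x=0}^{p^N-1}f(x)(-1)^x .$$ The falling factorial is $(y)_n=y(y-1)\cdots(y-n+1)$, with $(y)_0=1$. For an integer $k\ge 1$ and $n\ge 0$, the higher-order Changhee polynomials of the first kind are defined by the iterated integral $$Ch_n^{(k)}(x)=\int_{\mathbb{Z}_p}\cdots\int_{\mathbb{Z}_p}(x_1+\cdots+x_k+x)_n\,d\mu_{-1}(x_1)\cdots d\mu_{-1}(x_k),$$ where the integrand is expanded in powers of $x$ and integrated coefficientwise, giving a polynomial in $\mathbb{Q}_p[x]$. The Stirling numbers of the second kind $S_2(l,n)$ are defined by $(e^t-1)^n=n!\sum_{l=n}^\infty S_2(l,n)\frac{t^l}{l!}$ for $n\ge 0$. The Euler polynomials of order $k$, $E_n^{(k)}(x)\in\mathbb{Q}[x]\subset\mathbb{Q}_p[x]$, are defined by $\left(\frac{2}{e^t+1}\right)^k e^{xt}=\sum_{n=0}^\infty E_n^{(k)}(x)\frac{t^n}{n!}$. *)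

(* Defs.v *)
From HB Require Import structures.
From mathcomp Require Import all_boot all_order all_algebra.
From mathcomp Require Import fraction.
From mathcomp Require Import boolp classical_sets filter.
From mathcomp Require Import topology_structure separation_axioms.

Set Implicit Arguments.
Unset Strict Implicit.
Unset Printing Implicit Defensive.

Import Order.TTheory GRing.Theory Num.Theory.

Local Open Scope ring_scope.
Local Open Scope classical_set_scope.

(* Formal power series as coefficient sequences with the Cauchy product. *)

Record fps (R : Type) := Fps { fps_coef :> nat -> R }.

Section FpsRing.
Variable R : comNzRingType.
Implicit Types f g h : fps R.

HB.instance Definition _ := gen_eqMixin (fps R).
HB.instance Definition _ := gen_choiceMixin (fps R).

Lemma fpsP f g : f =1 g -> f = g.
Proof. by case: f g => [f] [g] /= /funext ->. Qed.

Definition fps_zero : fps R := Fps (fun=> 0).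
Definition fps_opp f : fps R := Fps (fun n => - f n).
Definition fps_add f g : fps R := Fps (fun n => f n + g n).
Definition fps_one : fps R := Fps (fun n => (n == 0)%:R).
Definition fps_mul f g : fps R := Fps (fun n => \sum_(i < n.+1) f i * g (n - i)%N).

Fact fps_addA : associative fps_add.
Proof. by move=> f g h; apply: fpsP => n /=; rewrite addrA. Qed.
Fact fps_addC : commutative fps_add.
Proof. by move=> f g; apply: fpsP => n /=; rewrite addrC. Qed.
Fact fps_add0 : left_id fps_zero fps_add.
Proof. by move=> f; apply: fpsP => n /=; rewrite add0r. Qed.
Fact fps_addN : left_inverse fps_zero fps_opp fps_add.
Proof. by move=> f; apply: fpsP => n /=; rewrite addNr. Qed.

HB.instance Definition _ :=
  GRing.isZmodule.Build (fps R) fps_addA fps_addC fps_add0 fps_addN.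

Let trunc f n : {poly R} := \poly_(i < n) f i.

Let fps_mulE f g n m : (n < m)%N -> fps_mul f g n = (trunc f m * trunc g m)`_n.
Proof.
move=> nm; rewrite coefM; apply: eq_bigr => i _; rewrite !coef_poly.
by rewrite (leq_ltn_trans (leq_subr _ _) nm) (leq_trans (ltn_ord i)).
Qed.

Fact fps_mulA : associative fps_mul.
Proof.
move=> f g h; apply: fpsP => n.
transitivity ((trunc f n.+1 * (trunc g n.+1 * trunc h n.+1))`_n).
  rewrite coefM; apply: eq_bigr => i _; rewrite coef_poly ltn_ord.
  by rewrite (@fps_mulE _ _ _ n.+1) // ltnS leq_subr.
rewrite mulrA coefM; apply: eq_bigr => i _.
by rewrite coef_poly ltnS leq_subr (@fps_mulE _ _ _ n.+1).
Qed.

Fact fps_mulC : commutative fps_mul.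
Proof.
by move=> f g; apply: fpsP => n; rewrite !(@fps_mulE _ _ _ n.+1) // mulrC.
Qed.

Fact fps_mul1 : left_id fps_one fps_mul.
Proof.
move=> f; apply: fpsP => n /=; rewrite big_ord_recl subn0 mul1r.
by rewrite big1 ?addr0 // => i _; rewrite mul0r.
Qed.

Fact fps_mulDl : left_distributive fps_mul fps_add.
Proof.
move=> f g h; apply: fpsP => n /=; rewrite -big_split /=.
by apply: eq_bigr => i _; rewrite mulrDl.
Qed.

Fact fps_one_neq0 : fps_one != 0.
Proof.
apply/eqP => /(congr1 (fun f : fps R => f 0%N)) /eqP.
by rewrite /= oner_eq0.
Qed.

HB.instance Definition _ := GRing.Zmodule_isComNzRing.Build (fps R)
  fps_mulA fps_mulC fps_mul1 fps_mulDl fps_one_neq0.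

Definition fps_unit : {pred fps R} := fun f => `[< exists g, g * f = 1 >].
Definition fps_inv f : fps R := xget f [set g | g * f = 1].

Fact fps_mulV : {in fps_unit, left_inverse 1 fps_inv *%R}.
Proof. by move=> f /asboolP [g gf]; rewrite /fps_inv; case: xgetP => // /(_ g). Qed.

Fact fps_unitP f g : g * f = 1 -> fps_unit f.
Proof. by move=> gf; apply/asboolP; exists g. Qed.

Fact fps_inv_out : {in [predC fps_unit], fps_inv =1 id}.
Proof.
move=> f /negP nf; rewrite /fps_inv; case: xgetP => // g _ gf.
by case: nf; apply: fps_unitP gf.
Qed.

HB.instance Definition _ :=
  GRing.ComNzRing_hasMulInverse.Build (fps R) fps_mulV fps_unitP fps_inv_out.

End FpsRing.

Section FpsUnit.
Variable R : comUnitRingType.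
Variable f : fps R.

Let s := fix s n : seq R := if n is m.+1 then
  rcons (s m) ((f 0)^-1 * ((m == 0)%:R - \sum_(i < m) (s m)`_i * f (m - i)%N))
  else [::].

Lemma fps_unitrE : (f \is a GRing.unit) = (f 0 \is a GRing.unit).
Proof.
apply/idP/idP => [/mulVr /(congr1 (fun h : fps R => h 0))|fU].
  by rewrite /= big_ord1 => e; apply/unitrPr; exists (f^-1 0); rewrite mulrC.
have size_s n : size (s n) = n by elim: n => //= n IH; rewrite size_rcons IH.
have sS n : s n.+1 = rcons (s n)
  ((f 0)^-1 * ((n == 0)%:R - \sum_(i < n) (s n)`_i * f (n - i)%N)) by [].
have nth_s n i : (i < n)%N -> (s n)`_i = (s i.+1)`_i.
  elim: n => // n IH; rewrite ltnS leq_eqVlt => /orP[/eqP -> //|lt_in].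
  by rewrite [s n.+1]sS nth_rcons size_s lt_in IH.
apply/unitrPr; exists (Fps (fun n => (s n.+1)`_n)); rewrite mulrC.
apply: fpsP => n; change (\sum_(i < n.+1) (s i.+1)`_i * f (n - i)%N = (n == 0)%:R).
rewrite big_ord_recr subnn [s n.+1]sS nth_rcons size_s ltnn eqxx.
rewrite mulrAC mulVr // mul1r (eq_bigr (fun i : 'I_n => (s n)`_i * f (n - i)%N)).
  by rewrite /= addrC subrK.
by move=> i _; rewrite (nth_s n i (ltn_ord i)).
Qed.

End FpsUnit.

Definition fps_exp (R : unitRingType) (a : R) : fps R :=
  Fps (fun n => a ^+ n / n`!%:R).

(* (e^t - 1)^n = n! * sum_(l >= n) S_2(l, n) * t^l / l! *)
Definition stirling2 (l n : nat) : rat :=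
  l`!%:R / n`!%:R * ((fps_exp 1 - 1) ^+ n : fps rat) l.

(* (2 / (e^t + 1))^k * e^(xt) = sum_n E_n^(k)(x) * t^n / n!,
   computed in Q[x][[t]]. *)
Definition euler_poly (k n : nat) : {poly rat} :=
  n`!%:R * ((2 / (fps_exp 1 + 1)) ^+ k * fps_exp 'X : fps {poly rat}) n.

(* The ring of p-adic integers, as the inverse limit of the Z / p^n Z: the n-th
   component is stored as its representative in [0, p^n); the equation below
   expresses both this normalization and the compatibility of the components.
   The primality proof is a phantom parameter; it makes the domain structure
   below canonical. *)

Record padic_int (p : nat) (p_prime : prime p) := PadicInt {
  padic_res :> nat -> int;
  padic_resP : forall n, padic_res n = (padic_res n.+1 %% (p ^ n)%N)%Z
}.

Section PadicInt.
Variables (p : nat) (p_prime : prime p).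
Local Notation Zp := (padic_int p_prime).
Implicit Types x y z : Zp.

HB.instance Definition _ := gen_eqMixin Zp.
HB.instance Definition _ := gen_choiceMixin Zp.

Lemma padic_intP x y : x =1 y -> x = y.
Proof.
case: x y => [x xP] [y yP] /= /funext xy; move: yP; rewrite -xy => yP.
by congr PadicInt; apply: Prop_irrelevance.
Qed.

Lemma padic_res_modS x n : (x n.+1 = x n %[mod (p ^ n)%N])%Z.
Proof. by rewrite [x n]padic_resP modz_mod. Qed.

Lemma padic_res_mod x n : (x n %% (p ^ n)%N)%Z = x n.
Proof. by rewrite [x n]padic_resP modz_mod. Qed.

Let modz_expS (a : int) n : ((a %% (p ^ n.+1)%N)%Z = a %[mod (p ^ n)%N])%Z.
Proof.
rewrite {2}(divz_eq a (p ^ n.+1)%N) expnSr PoszM mulrA mulrAC.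
by rewrite modzMDl.
Qed.

(* The p-adic integer given by a compatible sequence of residues. *)
Definition padic_of (a : nat -> int)
    (aP : forall n, (a n.+1 = a n %[mod (p ^ n)%N])%Z) : Zp :=
  @PadicInt p p_prime (fun n => (a n %% (p ^ n)%N)%Z)
    (fun n => esym (etrans (modz_expS _ n) (aP n))).

Fact padic_zero_subproof n : ((0 : int) = 0 %[mod (p ^ n)%N])%Z.
Proof. by []. Qed.
Fact padic_one_subproof n : ((1 : int) = 1 %[mod (p ^ n)%N])%Z.
Proof. by []. Qed.
Fact padic_opp_subproof x n : (- x n.+1 = - x n %[mod (p ^ n)%N])%Z.
Proof. by rewrite -modzNm padic_res_modS modzNm. Qed.
Fact padic_add_subproof x y n :
  (x n.+1 + y n.+1 = x n + y n %[mod (p ^ n)%N])%Z.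
Proof. by rewrite -modzDm !padic_res_modS modzDm. Qed.
Fact padic_mul_subproof x y n :
  (x n.+1 * y n.+1 = x n * y n %[mod (p ^ n)%N])%Z.
Proof. by rewrite -modzMm !padic_res_modS modzMm. Qed.

Definition padic_zero := padic_of padic_zero_subproof.
Definition padic_one := padic_of padic_one_subproof.
Definition padic_opp x := padic_of (padic_opp_subproof x).
Definition padic_add x y := padic_of (padic_add_subproof x y).
Definition padic_mul x y := padic_of (padic_mul_subproof x y).

Fact padic_addA : associative padic_add.
Proof.
by move=> x y z; apply: padic_intP => n /=; rewrite modzDmr modzDml addrA.
Qed.
Fact padic_addC : commutative padic_add.
Proof. by move=> x y; apply: padic_intP => n /=; rewrite addrC. Qed.
Fact padic_add0 : left_id padic_zero padic_add.
Proof.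
by move=> x; apply: padic_intP => n /=; rewrite mod0z add0r padic_res_mod.
Qed.
Fact padic_addN : left_inverse padic_zero padic_opp padic_add.
Proof.
by move=> x; apply: padic_intP => n /=; rewrite modzDml addNr.
Qed.

HB.instance Definition _ :=
  GRing.isZmodule.Build Zp padic_addA padic_addC padic_add0 padic_addN.

Fact padic_mulA : associative padic_mul.
Proof.
by move=> x y z; apply: padic_intP => n /=; rewrite modzMmr modzMml mulrA.
Qed.
Fact padic_mulC : commutative padic_mul.
Proof. by move=> x y; apply: padic_intP => n /=; rewrite mulrC. Qed.
Fact padic_mul1 : left_id padic_one padic_mul.
Proof.
move=> x; apply: padic_intP => n /=.
by rewrite modzMml mul1r padic_res_mod.
Qed.
Fact padic_mulDl : left_distributive padic_mul padic_add.
Proof.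
move=> x y z; apply: padic_intP => n /=.
by rewrite modzMml mulrDl modzDm.
Qed.
Fact padic_one_neq0 : padic_one != 0.
Proof.
apply/eqP => /(congr1 (fun x : Zp => x 1%N)) /=.
by rewrite mod0z expn1 modz_small ?oner_eq0 //= ltz_nat prime_gt1.
Qed.

HB.instance Definition _ := GRing.Zmodule_isComNzRing.Build Zp
  padic_mulA padic_mulC padic_mul1 padic_mulDl padic_one_neq0.

Definition padic_unit : {pred Zp} := fun x => `[< exists y, y * x = 1 >].
Definition padic_inv x : Zp := xget x [set y | y * x = 1].

Fact padic_mulV : {in padic_unit, left_inverse 1 padic_inv *%R}.
Proof.
by move=> x /asboolP [y yx]; rewrite /padic_inv; case: xgetP => // /(_ y).
Qed.

Fact padic_unitP x y : y * x = 1 -> padic_unit x.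
Proof. by move=> yx; apply/asboolP; exists y. Qed.

Fact padic_inv_out : {in [predC padic_unit], padic_inv =1 id}.
Proof.
move=> x /negP nx; rewrite /padic_inv; case: xgetP => // y _ yx.
by case: nx; apply: padic_unitP yx.
Qed.

HB.instance Definition _ := GRing.ComNzRing_hasMulInverse.Build Zp
  padic_mulV padic_unitP padic_inv_out.

Lemma padic_res_le x m n : (m <= n)%N -> x m = (x n %% (p ^ m)%N)%Z.
Proof.
move=> /subnK <-; elim: (n - m)%N => [|k IH]; first by rewrite padic_res_mod.
rewrite {}IH addSn [x (k + m)%N]padic_resP expnD PoszM addnC.
rewrite {2}(divz_eq (x (m + k).+1) (p ^ k * p ^ m)%N) PoszM mulrA.
by rewrite addnC modzMDl.
Qed.

Lemma padic_resD x y n : (x + y) n = ((x n + y n) %% (p ^ n)%N)%Z.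
Proof. by []. Qed.

Lemma padic_res_nat (k n : nat) : (k%:R : Zp) n = (k %% (p ^ n)%N)%Z.
Proof.
elim: k => // k IH; rewrite mulrS padic_resD IH.
by change (1 : Zp) with padic_one; rewrite /= modzDml modzDmr.
Qed.

Lemma padic_resM x y n : (x * y) n = ((x n * y n) %% (p ^ n)%N)%Z.
Proof. by []. Qed.

Lemma padic_neq0P x : reflect (exists n, ~~ ((p ^ n)%N %| x n)%Z) (x != 0).
Proof.
apply: (iffP idP) => [|[n]].
  apply: contraNP => nx; apply/eqP/padic_intP => n /=.
  rewrite mod0z -padic_res_mod; apply/eqP; apply: contraT => h.
  case: nx; exists n; apply: contra h => d; apply/eqP.
  exact/dvdz_mod0P.
by apply: contra => /eqP -> /=; rewrite mod0z dvdz0.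
Qed.

Let dvdn_prime_pow a b m n :
  (p ^ (a + b) %| m * n)%N -> (p ^ a %| m)%N || (p ^ b %| n)%N.
Proof.
have [->|m0] := posnP m; first by rewrite dvdn0.
have [->|n0] := posnP n; first by rewrite dvdn0 orbT.
rewrite !pfactor_dvdn ?muln_gt0 ?m0 //= lognM //.
case: (leqP a (logn p m)) => //= lt_ma le_ab; rewrite -(leq_add2l a).
by apply: leq_trans le_ab _; rewrite leq_add2r ltnW.
Qed.

Fact padic_integral : GRing.integral_domain_axiom Zp.
Proof.
move=> x y xy; apply: contraT => /norP[/padic_neq0P[a xa] /padic_neq0P[b yb]].
have := congr1 (fun z : Zp => z (a + b)%N) xy.
rewrite padic_resM /= mod0z => /dvdz_mod0P.
rewrite dvdzE abszM absz_nat => /dvdn_prime_pow /orP[h|h].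
  move: xa; rewrite (padic_res_le x (leq_addr b a)) => /negP[].
  by apply/dvdz_mod0P; rewrite modz_mod; apply/dvdz_mod0P.
move: yb; rewrite (padic_res_le y (leq_addl a b)) => /negP[].
by apply/dvdz_mod0P; rewrite modz_mod; apply/dvdz_mod0P.
Qed.

HB.instance Definition _ :=
  GRing.ComUnitRing_isIntegral.Build Zp padic_integral.

End PadicInt.

(* The field of p-adic numbers, with the topology for which the sets
   x + p^M Z_p form a basis of neighbourhoods of x. *)

Definition padic (p : nat) (p_prime : prime p) : Type :=
  {fraction (padic_int p_prime)}.

Section PadicTopology.
Variables (p : nat) (p_prime : prime p).
Local Notation Zp := (padic_int p_prime).
Local Notation Qp := (padic p_prime).

HB.instance Definition _ := GRing.Field.on Qp.
HB.instance Definition _ := isPointed.Build Qp 0.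

Definition padic_ball (x : Qp) (M : nat) : set Qp :=
  [set y | exists z : Zp, y - x = tofrac (p%:R ^+ M * z)].

HB.instance Definition _ :=
  hasNbhs.Build Qp (fun x => filter_from setT (padic_ball x)).

Lemma padic_ball_center x M : padic_ball x M x.
Proof. by exists 0; rewrite subrr mulr0 rmorph0. Qed.

Lemma padic_ball_trans x y z M :
  padic_ball x M y -> padic_ball y M z -> padic_ball x M z.
Proof.
move=> [a xy] [b yz]; exists (b + a).
by rewrite mulrDr rmorphD /= -xy -yz addrA subrK.
Qed.

Lemma padic_ball_sym x y M : padic_ball x M y -> padic_ball y M x.
Proof. by move=> [a xy]; exists (- a); rewrite mulrN rmorphN /= -xy opprB. Qed.

Lemma padic_ball_le x M N : (M <= N)%N -> padic_ball x N `<=` padic_ball x M.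
Proof.
move=> MN y [a xy]; exists (p%:R ^+ (N - M) * a).
by rewrite xy mulrA -exprD subnKC.
Qed.

Fact padic_nbhs_filter (x : Qp) : ProperFilter (nbhs x).
Proof.
apply: filter_from_proper => [|M _]; last by exists x; apply: padic_ball_center.
apply: filter_from_filter => [|M N _ _]; first by exists 0%N.
exists (maxn M N) => // y yMN.
by split; apply: padic_ball_le yMN; rewrite ?leq_maxl ?leq_maxr.
Qed.

Fact padic_nbhs_singleton (x : Qp) (A : set Qp) : nbhs x A -> A x.
Proof. by move=> [M _ sMA]; apply/sMA/padic_ball_center. Qed.

Fact padic_nbhs_nbhs (x : Qp) (A : set Qp) : nbhs x A -> nbhs x (nbhs^~ A).
Proof.
move=> [M _ sMA]; exists M => // y xy; exists M => // z yz.
by apply: sMA; apply: padic_ball_trans yz.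
Qed.

HB.instance Definition _ := Nbhs_isNbhsTopological.Build Qp
  padic_nbhs_filter padic_nbhs_singleton padic_nbhs_nbhs.

Lemma padic_hausdorff : hausdorff_space Qp.
Proof.
move=> x y xy; apply/eqP; rewrite eq_sym -subr_eq0.
have {}xy M : padic_ball x M y.
  have [||z [xz yz]] := xy (padic_ball x M) (padic_ball y M); try by exists M.
  exact: padic_ball_trans xz (padic_ball_sym yz).
have [w yxw] := xy 0%N; rewrite yxw expr0 mul1r tofrac_eq0.
apply/eqP/padic_intP => M; have [z] := xy M.
rewrite yxw expr0 mul1r => /eqP; rewrite tofrac_eq => /eqP ->.
by rewrite padic_resM -natrX padic_res_nat modzz mul0r /=.
Qed.

End PadicTopology.

Section Changhee.
Variables (p : nat) (p_prime : prime p).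
Local Notation Zp := (padic_int p_prime).
Local Notation Qp := (padic p_prime).

(* Defined for every f: an arbitrary value is returned when the limit does not
   exist; the limit is unique by padic_hausdorff. *)
Definition fermionic_integral (f : Zp -> Qp) : Qp :=
  limn (fun N => \sum_(0 <= x < p ^ N) f x%:R * (-1) ^+ x).

(* The tuple lists x_1, ..., x_k; the integral in x_1 is the innermost one. *)
Fixpoint fermionic_iterated_integral (k : nat) : (k.-tuple Zp -> Qp) -> Qp :=
  match k with
  | 0 => fun f => f [tuple]
  | k'.+1 => fun f => fermionic_integral (fun x =>
      fermionic_iterated_integral (fun t : k'.-tuple Zp => f [tuple of rcons t x]))
  end.

Definition falling_factorial (R : pzRingType) (y : R) (n : nat) : R :=
  \prod_(i < n) (y - i%:R).

(* The integrand is a polynomial of degree n in 'X over the p-adic integers. *)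
Definition changhee_poly (k n : nat) : {poly Qp} :=
  \poly_(j < n.+1) fermionic_iterated_integral (fun t : k.-tuple Zp =>
    tofrac (falling_factorial ((\sum_(y <- t) y)%:P + 'X) n)`_j).

End Changhee.

(* Main.v *)
(* Call g a fermionic primitive of a polynomial f if g(X + 1) + g(X) = 2 f(X).
   The alternating sum of f over [0, p^N) then telescopes to
   (g(0) + g(p^N)) / 2, which tends to g(0): fermionic integration of f(x + X)
   in x yields g(X).  Hence Ch^(k)_n is the k-th iterated primitive of (X)_n,
   while the generating function shows that E^(k)_m is the k-th iterated
   primitive of X^m.  Primitives are linear and unique, so the theorem reduces
   to the identity X^m = sum_n S_2(m, n) (X)_n. *)

Require Import Defs.
From HB Require Import structures.
From mathcomp Require Import all_boot all_order all_algebra.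
From mathcomp Require Import fraction ring zify.
From mathcomp Require Import boolp classical_sets filter.
From mathcomp Require Import topology_structure separation_axioms.

Set Implicit Arguments.
Unset Strict Implicit.
Unset Printing Implicit Defensive.

Import GRing.Theory Num.Theory.
Local Open Scope ring_scope.

(** * Polynomial shifts, fermionic primitives and falling factorials *)

Lemma comp_poly_XaddC_XaddC (R : comNzRingType) (f : {poly R}) (a b : R) :
  f \Po ('X + a%:P) \Po ('X + b%:P) = f \Po ('X + (a + b)%:P).
Proof.
by rewrite -comp_polyA comp_polyD comp_polyX comp_polyC polyCD addrAC addrA.
Qed.

(** With c = p^N this makes g(X + p^N) tend to g coefficientwise. *)
Lemma comp_poly_XaddC_addr (R : comNzRingType) (f : {poly R}) (a c : R) :
  exists w : {poly R},
    f \Po ('X + (a + c)%:P) = f \Po ('X + a%:P) + c *: w.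
Proof.
elim/poly_ind: f => [|f b [w IH]].
  by exists 0; rewrite !comp_poly0 scaler0 addr0.
exists (w * ('X + (a + c)%:P) + (f \Po ('X + a%:P))).
rewrite !comp_poly_MXaddC IH !polyCD -!mul_polyC; ring.
Qed.

Definition fermionic_primitive (R : nzRingType) (f g : {poly R}) :=
  g \Po ('X + 1%:P) + g = f *+ 2.

(** Leading terms cancel. This drop in degree drives both the construction of primitives and their
    uniqueness. *)
Lemma size_sub_shift (R : comNzRingType) (f : {poly R}) :
  (size (f \Po ('X + 1%:P) - f)%R <= (size f).-1)%N.
Proof.
elim/poly_ind: f => [|f b IH]; first by rewrite comp_poly0 subr0 size_poly0.
have [->|f0] := eqVneq f 0.
  by rewrite mul0r add0r comp_polyC subrr size_poly0.
rewrite size_MXaddC (negbTE f0) /=.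
have -> : (f * 'X + b%:P) \Po ('X + 1%:P) - (f * 'X + b%:P) =
   (f \Po ('X + 1%:P) - f) * 'X + (f \Po ('X + 1%:P)).
  by rewrite comp_poly_MXaddC; ring.
apply: leq_trans (size_polyD _ _) _; rewrite geq_max.
have le_shift : (size (f \Po ('X + 1%:P)) <= size f)%N.
  rewrite (_ : f \Po _ = f \Po ('X + 1%:P) - f + f); last by rewrite subrK.
  apply: leq_trans (size_polyD _ _) _; rewrite geq_max leqnn andbT.
  exact: leq_trans IH (leq_pred _).
rewrite le_shift andbT; have [->|d0] := eqVneq (f \Po ('X + 1%:P) - f) 0.
  by rewrite mul0r size_poly0.
by rewrite size_mulX // (leq_ltn_trans IH) // prednK // lt0n size_poly_eq0.
Qed.

Lemma fermionic_primitive_exists (R : comUnitRingType) (f : {poly R}) :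
  2 \is a @GRing.unit R -> exists g, fermionic_primitive f g.
Proof.
move=> u2; rewrite /fermionic_primitive.
elim: (size f) {-2}f (leqnn (size f)) => {f} [|n IH] f fn.
  move: fn; rewrite leqn0 size_poly_eq0 => /eqP ->.
  by exists 0; rewrite comp_poly0 addr0 mul0rn.
(* Taking f itself as primitive leaves the error f - f(X + 1), of smaller size; [h] is a primitive
   of half of it. *)
have [|h hE] := IH (2^-1 *: (f - (f \Po ('X + 1%:P)))).
  apply: leq_trans (size_scale_leq _ _) _.
  rewrite -opprB size_polyN; apply: leq_trans (size_sub_shift f) _.
  by rewrite -ltnS; case: (size f) fn.
exists (f + h); rewrite comp_polyD addrACA hE -scaler_nat scalerA divrr //.
by rewrite scale1r; ring.
Qed.

(** The sum is 2g plus a difference of smaller degree. Hence the linear map from g to g(X + 1) + g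
    has zero kernel. *)
Lemma size_shift_add (R : idomainType) (g : {poly R}) :
  2 != 0 :> R -> size (g \Po ('X + 1%:P) + g)%R = size g.
Proof.
move=> n2; have s : size (g *+ 2) = size g by rewrite -scaler_nat size_scale.
have [->|g0] := eqVneq g 0; first by rewrite comp_poly0 addr0.
rewrite (_ : _ + g = g *+ 2 + (g \Po ('X + 1%:P) - g)); last by ring.
rewrite size_polyDl ?s //; apply: leq_ltn_trans (size_sub_shift g) _.
by rewrite prednK // lt0n size_poly_eq0.
Qed.

Lemma size_fermionic_primitive (R : idomainType) (f g : {poly R}) :
  2 != 0 :> R -> fermionic_primitive f g -> size g = size f.
Proof.
by move=> n2 fg; rewrite -(size_shift_add g n2) fg -scaler_nat size_scale.
Qed.

Lemma fermionic_primitive_inj (R : idomainType) (f g h : {poly R}) :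
  2 != 0 :> R -> fermionic_primitive f g -> fermionic_primitive f h -> g = h.
Proof.
move=> n2 fg fh; apply/eqP; rewrite -subr_eq0 -size_poly_eq0.
rewrite -(size_shift_add _ n2) comp_polyB addrACA -opprD.
by rewrite fg fh subrr size_poly0.
Qed.

Lemma fermionic_primitive_map (R S : comNzRingType) (phi : {rmorphism R -> S})
    (f g : {poly R}) :
  fermionic_primitive f g ->
  fermionic_primitive (map_poly phi f) (map_poly phi g).
Proof.
rewrite /fermionic_primitive => fg.
rewrite -rmorphMn /= -fg rmorphD /= map_comp_poly rmorphD /= map_polyX.
by rewrite map_polyC /= rmorph1.
Qed.

Lemma fermionic_primitive_shift (R : comNzRingType) (f g : {poly R}) (a : R) :
  fermionic_primitive f g ->
  fermionic_primitive (f \Po ('X + a%:P)) (g \Po ('X + a%:P)).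
Proof.
rewrite /fermionic_primitive => fg.
rewrite comp_poly_XaddC_XaddC addrC [a + 1]addrC -comp_poly_XaddC_XaddC addrC.
by rewrite -comp_polyD fg -rmorphMn.
Qed.

Lemma fermionic_primitive_sum (R : comNzRingType) (I : Type) (r : seq I)
    (c : I -> R) (F G : I -> {poly R}) :
  (forall i, fermionic_primitive (F i) (G i)) ->
  fermionic_primitive (\sum_(i <- r) c i *: F i) (\sum_(i <- r) c i *: G i).
Proof.
rewrite /fermionic_primitive => FG; rewrite linear_sum -big_split -sumrMnl /=.
by apply: eq_bigr => i _; rewrite linearZ /= -scalerDr FG scalerMnr.
Qed.

Lemma alternating_sum_primitive (R : comNzRingType) (f g : {poly R}) (n : nat) :
  fermionic_primitive f g ->
  (\sum_(0 <= i < n) (-1) ^+ i *: (f \Po ('X + i%:R%:P))) *+ 2 =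
  g - (-1) ^+ n *: (g \Po ('X + n%:R%:P)).
Proof.
move=> fg; elim: n => [|n IH].
  by rewrite big_geq // addr0 comp_polyXr scale1r subrr mul0rn.
rewrite big_nat_recr //= mulrnDl IH scalerMnr.
have /esym -> := fermionic_primitive_shift n%:R fg.
rewrite comp_poly_XaddC_XaddC -natr1 scalerDr exprS mulN1r scaleNr opprK.
by rewrite addrACA addNr addr0.
Qed.

(* Unqualified, falling_factorial is MathComp's function on nat. *)
Lemma falling_factorial_shift (R : comNzRingType) (c : R) (n : nat) :
  Defs.falling_factorial (c%:P + 'X) n =
    Defs.falling_factorial 'X n \Po ('X + c%:P).
Proof.
rewrite /Defs.falling_factorial rmorph_prod; apply: eq_bigr => i _ /=.
by rewrite comp_polyB comp_polyX -polyC_natr comp_polyC [c%:P + _]addrC.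
Qed.

Lemma size_falling_factorialX (R : comNzRingType) (n : nat) :
  (size (Defs.falling_factorial ('X : {poly R}) n) <= n.+1)%N.
Proof.
rewrite /Defs.falling_factorial.
rewrite (eq_bigr (fun i : 'I_n => 'X - (i%:R)%:P)) => [|i _]; last first.
  by rewrite polyC_natr.
by rewrite size_prod_XsubC /index_enum -enumT size_enum_ord.
Qed.

(** * Fermionic integrals over Z_p and Changhee polynomials *)

Section Padic.
Variables (p : nat) (p_prime : prime p).
Hypothesis p_odd : odd p.
Local Notation Zp := (padic_int p_prime).
Local Notation Qp := (padic p_prime).

Let expn_oddE n : (p ^ n = (p ^ n)./2.*2.+1)%N.
Proof. by rewrite -[LHS]odd_double_half oddX p_odd orbT. Qed.

(** The residue of 1/2: its double is p^n + 1. *)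
Let half_res n : int := (p ^ n).+1./2%N.

Let half_resP n : (half_res n.+1 = half_res n %[mod (p ^ n)%N])%Z.
Proof.
rewrite /half_res.
have pE : p = p./2.*2.+1 by rewrite -[LHS]odd_double_half p_odd.
(* Consecutive residues differ by p^n (p - 1)/2. *)
suff -> : ((p ^ n.+1).+1./2 = p./2 * p ^ n + (p ^ n).+1./2)%N.
  by rewrite PoszD PoszM modzMDl.
rewrite expnS {1}pE (expn_oddE n); move: (p ^ n)./2 p./2 => q r.
have -> : ((r.*2.+1 * q.*2.+1).+1 = (r * q.*2.+1 + q.+1).*2)%N by lia.
by rewrite doubleK -doubleS doubleK.
Qed.

Lemma padic_int_unit2 : 2 \is a @GRing.unit Zp.
Proof.
apply/unitrPr; exists (padic_of p_prime half_resP).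
apply: padic_intP => n; rewrite padic_resM padic_res_nat.
rewrite -[1]/(1%:R) padic_res_nat /= modzMm -PoszM mul2n.
have -> : ((p ^ n).+1./2.*2 = p ^ n + 1)%N.
  by rewrite (expn_oddE n) -doubleS doubleK doubleS addn1.
by rewrite PoszD modzDl.
Qed.

Lemma padic_int_natf_neq0 (n : nat) : (0 < n)%N -> n%:R != 0 :> Zp.
Proof.
(* Level n suffices because 0 < n < p^n. *)
move=> n0; apply/padic_neq0P; exists n; rewrite padic_res_nat.
rewrite dvdzE modz_nat !absz_nat /dvdn modn_mod.
apply: contraL (ltn_expl n (prime_gt1 p_prime)) => pn_n.
by rewrite -leqNgt dvdn_leq.
Qed.

Lemma padic_natf_neq0 (n : nat) : (0 < n)%N -> n%:R != 0 :> Qp.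
Proof.
by move=> n0; rewrite -(rmorph_nat (@tofrac Zp)) tofrac_eq0 padic_int_natf_neq0.
Qed.

Lemma fermionic_integral_primitive (f g : {poly Zp}) (u : Zp) (j : nat) :
  fermionic_primitive f g ->
  fermionic_integral (fun x => tofrac (f \Po ('X + (x + u)%:P))`_j : Qp) =
  tofrac (g \Po ('X + u%:P))`_j.
Proof.
move=> fg; apply: cvg_lim; first exact: padic_hausdorff.
move=> A [M _ MA]; exists M => // N /= MN.
apply/MA/padic_ball_le; first exact: MN.
set F := f \Po ('X + u%:P); set G := g \Po ('X + u%:P).
have FG : fermionic_primitive F G by apply: fermionic_primitive_shift.
have [w wE] := comp_poly_XaddC_addr G 0 (p ^ N)%:R.
have sE := alternating_sum_primitive (p ^ N) FG.
(* As p^N is odd, [sE] and [wE] make twice the partial sum equal to G + G(X + p^N) = 2G + p^N w, so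
   its distance from G is p^N w/2, with 2 invertible in Z_p. *)
exists (2^-1 * w`_j).
rewrite (_ : \sum_(0 <= x < _) _ =
    tofrac ((\sum_(0 <= i < p ^ N) (-1) ^+ i *: (F \Po ('X + i%:R%:P)))`_j)).
  rewrite -rmorphB -coefB; congr tofrac.
  apply: (mulrI padic_int_unit2).
  rewrite [RHS]mulrCA (mulVKr padic_int_unit2) -natrX -!coefZ.
  congr (polyseq _)`_j; rewrite scalerBr !(scaler_nat 2) sE.
  rewrite -signr_odd oddX p_odd orbT scaleN1r opprK -[(p ^ N)%:R]add0r wE.
  by rewrite polyC0 addr0 comp_polyXr mulr2n addrA [LHS]addrC addKr add0r.
rewrite coef_sum rmorph_sum; apply: eq_bigr => i _ /=.
rewrite coefZ mulrC rmorphM rmorphXn rmorphN1 comp_poly_XaddC_XaddC.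
by rewrite [u + _]addrC.
Qed.

(** The offset [u] must be general for the induction: once the outermost variable x is fixed, the
    inner integrals see the offset x + u. *)
Lemma fermionic_iterated_integral_primitive (P : nat -> {poly Zp}) :
    (forall i, fermionic_primitive (P i) (P i.+1)) ->
  forall (k : nat) (u : Zp) (j : nat),
  fermionic_iterated_integral (fun t : k.-tuple Zp =>
    tofrac (P 0 \Po ('X + (\sum_(y <- t) y + u)%:P))`_j : Qp) =
  tofrac (P k \Po ('X + u%:P))`_j.
Proof.
move=> PP; elim=> [|k IH] u j /=; first by rewrite big_nil add0r.
rewrite -(fermionic_integral_primitive u j (PP k)).
congr fermionic_integral; apply/funext => x; rewrite -IH.
congr fermionic_iterated_integral; apply/funext => t.
by rewrite big_rcons /= addrA.
Qed.

Lemma fermionic_primitive_seq (f : {poly Zp}) :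
  exists2 P : nat -> {poly Zp},
    P 0 = f & forall i, fermionic_primitive (P i) (P i.+1).
Proof.
have /choice [T TP] : forall h : {poly Zp}, exists g, fermionic_primitive h g.
  by move=> h; apply: fermionic_primitive_exists padic_int_unit2.
by exists (fun i => iter i T f).
Qed.

Lemma changhee_polyE (P : nat -> {poly Zp}) (k n : nat) :
    P 0 = Defs.falling_factorial 'X n ->
    (forall i, fermionic_primitive (P i) (P i.+1)) ->
  changhee_poly p_prime k n = map_poly (@tofrac Zp) (P k).
Proof.
move=> P0 PP; apply/polyP => j; rewrite coef_poly coef_map /=.
(* Primitives keep the size, so the cut at n + 1 coefficients in [changhee_poly] loses nothing. *)
have sP i : (size (P i) <= n.+1)%N.
  elim: i => [|i IH]; first by rewrite P0 size_falling_factorialX.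
  by rewrite (size_fermionic_primitive _ (PP i)) ?padic_int_natf_neq0.
case: ltnP => [_|nj]; last first.
  by rewrite nth_default ?rmorph0 // (leq_trans (sP k)).
(* [P k] is written as P_k(X + 0) to match the integral formula at u = 0. *)
rewrite -[P k]comp_polyXr -[X in _ \Po X]addr0.
rewrite -(fermionic_iterated_integral_primitive PP).
congr fermionic_iterated_integral; apply/funext => t.
by rewrite falling_factorial_shift P0 addr0.
Qed.

Lemma changhee_poly0 (n : nat) :
  changhee_poly p_prime 0 n = Defs.falling_factorial 'X n.
Proof.
have [P P0 PP] := fermionic_primitive_seq (Defs.falling_factorial 'X n).
rewrite (changhee_polyE 0 P0 PP) P0 /Defs.falling_factorial rmorph_prod.
by apply: eq_bigr => i _; rewrite rmorphB /= map_polyX rmorph_nat.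
Qed.

Lemma changhee_poly_primitive (k n : nat) :
  fermionic_primitive (changhee_poly p_prime k n)
    (changhee_poly p_prime k.+1 n).
Proof.
have [P P0 PP] := fermionic_primitive_seq (Defs.falling_factorial 'X n).
by rewrite !(changhee_polyE _ P0 PP); apply: fermionic_primitive_map.
Qed.

End Padic.

(** * Coefficientwise morphisms and exponential series *)

Lemma fps_coef_sum (R : comNzRingType) (I : Type) (r : seq I) (F : I -> fps R)
    (m : nat) :
  (\sum_(i <- r) F i) m = \sum_(i <- r) F i m.
Proof. by elim/big_ind2: _ => // x y z t; exact: (congr2 +%R). Qed.

Section FpsMap.
Variables (R S : comNzRingType) (phi : {rmorphism R -> S}).

Definition fps_map (f : fps R) : fps S := Fps (fun n => phi (f n)).

Fact fps_map_is_zmod_morphism : zmod_morphism fps_map.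
Proof. by move=> f g; apply: fpsP => n; rewrite /= rmorphB. Qed.

Fact fps_map_is_monoid_morphism : monoid_morphism fps_map.
Proof.
split=> [|f g]; apply: fpsP => n /=; first by rewrite rmorph_nat.
by rewrite rmorph_sum; apply: eq_bigr => i _; rewrite rmorphM.
Qed.

HB.instance Definition _ := GRing.isZmodMorphism.Build _ _ fps_map
  fps_map_is_zmod_morphism.
HB.instance Definition _ := GRing.isMonoidMorphism.Build _ _ fps_map
  fps_map_is_monoid_morphism.

End FpsMap.

Section FpsExp.
Variable R : comUnitRingType.
Hypothesis natU : forall n, n.+1%:R \is a @GRing.unit R.

Lemma fact_unit (n : nat) : n`!%:R \is a @GRing.unit R.
Proof. by case: n`! (fact_gt0 n). Qed.

Lemma fps_exp0 : fps_exp (0 : R) = 1.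
Proof.
apply: fpsP => -[|n] /=; first by rewrite divr1.
by rewrite expr0n mul0r.
Qed.

(** In degree n this is the binomial theorem divided by n!. *)
Lemma fps_expD (a b : R) : fps_exp (a + b) = fps_exp a * fps_exp b.
Proof.
apply: fpsP => n /=; rewrite addrC exprDn mulr_suml; apply: eq_bigr => i _.
apply: (mulIr (fact_unit n)); rewrite divrK ?fact_unit //.
rewrite -[in RHS](bin_fact (n := n) (m := i)) -1?ltnS // !natrM.
rewrite [b ^+ _ * _]mulrC -mulr_natr.
rewrite (_ : _ / _ * _ * _ = a ^+ i * b ^+ (n - i) * 'C(n, i)%:R *
  (i`!%:R / i`!%:R) * ((n - i)`!%:R / (n - i)`!%:R)); last ring.
by rewrite !divrr ?fact_unit // !mulr1.
Qed.

Lemma fps_expX (a : R) (n : nat) : fps_exp a ^+ n = fps_exp (a *+ n).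
Proof.
elim: n => [|n IH]; first by rewrite mulr0n fps_exp0.
by rewrite exprS IH mulrS fps_expD.
Qed.

End FpsExp.

Lemma fps_map_exp (R S : comUnitRingType) (phi : {rmorphism R -> S}) (a : R) :
    (forall n, n.+1%:R \is a @GRing.unit R) ->
  fps_map phi (fps_exp a) = fps_exp (phi a).
Proof.
move=> natU; apply: fpsP => n /=.
by rewrite rmorphM rmorphXn rmorphV ?fact_unit // rmorph_nat.
Qed.

(** * Stirling expansion of powers *)

Lemma falling_factorial_nat (R : pzRingType) (a n : nat) :
  Defs.falling_factorial (a%:R : R) n = (a ^_ n)%:R.
Proof.
elim: n => [|n IH]; first by rewrite /Defs.falling_factorial big_ord0.
rewrite ffactnSr natrM -IH /Defs.falling_factorial big_ord_recr /=.
have [na|an] := leqP n a; first by rewrite natrB.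
(* For a < n the truncated difference a - n is not the ring difference, but both products already
   vanish. *)
by rewrite -/(Defs.falling_factorial a%:R n) IH ffact_small // !mul0r.
Qed.

Lemma sum_stirling2_falling_factorial (m : nat) :
  \sum_(0 <= n < m.+1) stirling2 m n *: Defs.falling_factorial 'X n = 'X^m.
Proof.
have natU n : n.+1%:R \is a @GRing.unit rat by rewrite unitfE pnatr_eq0.
apply/eqP; rewrite -subr_eq0; apply/eqP.
(* Both sides have degree at most m and agree at 0, ..., m. *)
apply: (@roots_geq_poly_eq0 _ _ [seq i%:R | i <- iota 0 m.+1]); last first.
- rewrite size_map size_iota (leq_trans (size_polyD _ _)) //.
  rewrite geq_max size_polyN size_polyXn leqnn andbT.
  rewrite big_mkord; apply: (leq_trans (size_sum _ _ _)).
  apply/bigmax_leqP => i _; apply: leq_trans (size_scale_leq _ _) _.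
  exact: leq_trans (size_falling_factorialX _ _) (ltn_ord i).
- rewrite map_inj_uniq ?iota_uniq // => i j /eqP.
  by rewrite eqr_nat => /eqP.
apply/allP => _ /mapP[a ra ->].
have {ra} am : (a <= m)%N by move: ra; rewrite mem_iota ltnS.
rewrite /root hornerD hornerN hornerXn subr_eq0; apply/eqP.
rewrite horner_sum.
(* a^m is m! times the coefficient of t^m in e^(at) = ((e^t - 1) + 1)^a. Expanding binomially and
   using C(a, n) n! = (a)_n yields the Stirling sum at a. *)
transitivity (m`!%:R * (fps_exp (1 : rat) ^+ a) m); last first.
  by rewrite fps_expX //= mulrCA divff ?mulr1 // pnatr_eq0 -lt0n fact_gt0.
rewrite -[fps_exp 1](subrK 1) exprD1n fps_coef_sum mulr_sumr.
rewrite -(big_mkord xpredT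
  (fun n => m`!%:R * ((fps_exp 1 - 1) ^+ n *+ 'C(a, n) : fps rat) m)).
(* The binomial sum stops at a <= m; the Stirling terms with a < n <= m vanish since C(a, n) = 0. *)
rewrite [RHS](big_nat_widen _ _ m.+1) // [RHS]big_mkcond.
apply: eq_big_nat => n _.
rewrite hornerZ /Defs.falling_factorial horner_prod.
rewrite (eq_bigr (fun i : 'I_n => a%:R - i%:R)) => [|i _]; last first.
  by rewrite hornerD hornerX hornerN -polyC_natr hornerC.
rewrite -/(Defs.falling_factorial a%:R n) falling_factorial_nat.
rewrite -bin_ffact natrM.
have -> : ((fps_exp 1 - 1) ^+ n *+ 'C(a, n) : fps rat) m =
  ((fps_exp 1 - 1) ^+ n : fps rat) m *+ 'C(a, n).
  by elim: 'C(a, n) => // i IH; rewrite !mulrS -IH.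
rewrite /stirling2 -mulr_natr ltnS; case: leqP => [_|an].
  by field; rewrite pnatr_eq0 -lt0n fact_gt0.
by rewrite bin_small // !mul0r mulr0.
Qed.

(** * Euler polynomials as iterated primitives *)

Lemma poly_rat_natr_unit (n : nat) : n.+1%:R \is a @GRing.unit {poly rat}.
Proof.
by rewrite poly_unitE -polyC_natr size_polyC coefC unitfE pnatr_eq0.
Qed.

Lemma euler_poly0 (m : nat) : euler_poly 0 m = 'X^m.
Proof.
rewrite /euler_poly expr0 mul1r /= mulrCA divrr ?mulr1 //.
exact/fact_unit/poly_rat_natr_unit.
Qed.

(** Shifting X by 1 multiplies e^(Xt) by e^t and fixes A = 2/(e^t + 1), so the sum has generating
    function A^(k+1) e^(Xt) (e^t + 1) = 2 A^k e^(Xt). *)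
Lemma euler_poly_primitive (k m : nat) :
  fermionic_primitive (euler_poly k m) (euler_poly k.+1 m).
Proof.
have natU := poly_rat_natr_unit.
pose A : fps {poly rat} := 2 / (fps_exp 1 + 1).
have unitE1 : fps_exp 1 + 1 \is a @GRing.unit (fps {poly rat}).
  (* The constant term is 2. *)
  by rewrite fps_unitrE /= divr1 (natU 1).
pose sigma := fps_map (comp_poly ('X + 1%:P : {poly rat})).
have sigmaA : sigma A = A.
  rewrite /sigma /A rmorphM rmorph_nat rmorphV // rmorphD.
  by rewrite /= fps_map_exp //= !rmorph1.
have AE : A * (fps_exp 1 + 1) = 2 by rewrite divrK.
rewrite /fermionic_primitive.
have -> : euler_poly k.+1 m \Po ('X + 1%:P) =
    m`!%:R * (A ^+ k.+1 * (fps_exp 'X * fps_exp 1)) m.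
  rewrite -fps_expD // /euler_poly rmorphM /= rmorph_nat; congr (_ * _).
  rewrite -[LHS]/(sigma (A ^+ k.+1 * fps_exp 'X) m).
  have -> : sigma (A ^+ k.+1 * fps_exp 'X) =
      sigma A ^+ k.+1 * sigma (fps_exp 'X).
    by rewrite /sigma rmorphM rmorphXn.
  by rewrite sigmaA /sigma fps_map_exp //= comp_polyX.
rewrite /euler_poly -/A -mulrDr -mulrnAr; congr (_ * _).
rewrite -[LHS]/((A ^+ k.+1 * (fps_exp 'X * fps_exp 1) +
  A ^+ k.+1 * fps_exp 'X) m).
have -> : A ^+ k.+1 * (fps_exp 'X * fps_exp 1) + A ^+ k.+1 * fps_exp 'X =
   A ^+ k * fps_exp 'X * (A * (fps_exp 1 + 1)) by rewrite exprS; ring.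
by rewrite AE mulr_natr mulr2n.
Qed.

(** * Passage from the rationals to the p-adic numbers *)

Lemma ratr_rmorphism (F : fieldType) :
    (forall n, n.+1%:R != 0 :> F) ->
  exists phi : {rmorphism rat -> F}, phi =1 ratr.
Proof.
move=> natF; have intF (z : int) : z != 0 -> z%:~R != 0 :> F.
  by case: z => [[|n]|n] // _; rewrite ?natF // NegzE rmorphN oppr_eq0 natF.
have denF x : (denq x)%:~R != 0 :> F by rewrite intF.
(* [ratr] reads the reduced fraction, while the usual formulas for sums and products give unreduced
   ones; any representation has the same value. *)
have ratrE (a b : int) (x : rat) : b != 0 -> x * b%:~R = a%:~R ->
    ratr x = a%:~R / b%:~R :> F.
  move=> b0 xE; apply/eqP; rewrite /ratr eqr_div ?intF // -!rmorphM /=.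
  apply/eqP; congr _%:~R; apply: (@intr_inj rat).
  by rewrite !rmorphM /= -xE numqE; ring.
have ratrB : zmod_morphism (@ratr F).
  move=> x y.
  rewrite (ratrE (numq x * denq y - numq y * denq x) (denq x * denq y)).
  - by rewrite rmorphB !rmorphM /= /ratr; field; rewrite !denF.
  - by rewrite mulf_neq0 ?denq_eq0.
  by rewrite rmorphB !rmorphM /= !numqE; ring.
have ratrM : monoid_morphism (@ratr F).
  split=> [|x y]; first by rewrite /ratr divr1.
  rewrite (ratrE (numq x * numq y) (denq x * denq y)).
  - by rewrite !rmorphM /= /ratr; field; rewrite !denF.
  - by rewrite mulf_neq0 ?denq_eq0.
  by rewrite !rmorphM /= !numqE; ring.
pose phi : {rmorphism rat -> F} := HB.pack (@ratr F)
    (GRing.isZmodMorphism.Build _ _ _ ratrB)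
    (GRing.isMonoidMorphism.Build _ _ _ ratrM).
by exists phi.
Qed.

Theorem theorem2p5 (p : nat) (p_prime : prime p) (p_odd : odd p)
    (k : nat) (k_ge1 : (1 <= k)%N) (m : nat) :
  map_poly (@ratr (padic p_prime)) (euler_poly k m) =
  \sum_(0 <= n < m.+1) ratr (stirling2 m n) *: changhee_poly p_prime k n.
Proof.
(* The library makes ratr a morphism only into a numFieldType. *)
have [phi phiE] :=
  ratr_rmorphism (fun n => padic_natf_neq0 p_prime (ltn0Sn n)).
(* At k = 0 the identity is the Stirling expansion of X^m carried to Q_p. *)
rewrite -(eq_map_poly phiE); elim: k {k_ge1} => [|k IH].
  rewrite euler_poly0 -sum_stirling2_falling_factorial rmorph_sum.
  apply: eq_bigr => n _ /=; rewrite map_polyZ -phiE (changhee_poly0 _ p_odd).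
  congr (_ *: _); rewrite /Defs.falling_factorial rmorph_prod.
  by apply: eq_bigr => i _; rewrite rmorphB /= map_polyX rmorph_nat.
(* Both sides at k + 1 are primitives of the common value at k. *)
apply: (@fermionic_primitive_inj _ (map_poly phi (euler_poly k m))).
- exact: padic_natf_neq0.
- exact/fermionic_primitive_map/euler_poly_primitive.
rewrite IH; apply: fermionic_primitive_sum => n.
exact: changhee_poly_primitive.
Qed.
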